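(* For $k\in\mathbb{Z}$, $\dim \mathrm{BDer}_{k}(\mathfrak{m}_0)=1$ if $k\geq -1$, and $\dim \mathrm{BDer}_{k}(\mathfrak{m}_0)=0$ if $k\leq -2$. In particular, for $k\geq -1$, $\mathrm{BDer}_{k}(\mathfrak{m}_0)$ is spanned by $\sum_{i\geq 2}e^{1,i}_{1+i+k}$, i.e. by the skew-symmetric bilinear map $f$ with $f(e_1,e_i)=e_{1+i+k}$ for all $i\geq 2$ and $f(e_i,e_j)=0$ for all $i,j\geq 2$.
   Context: The ground field $\mathbb{F}$ is algebraically closed of characteristic zero. $\mathbb{N}=\{1,2,3,\dots\}$. $\mathfrak{m}_0$ is the $\mathbb{N}$-graded Lie algebra over $\mathbb{F}$ with basis $\{e_i\mid i\geq 1\}$, $e_i$ homogeneous of degree $i$, whose only non-trivial brackets (up to skew-symmetry) are $[e_1,e_i]=e_{i+1}$ for all $i\geq 2$. Its degree-$i$ component is $(\mathfrak{m}_0)_i=\mathbb{F}e_i$ for $i\ge 1$, and $(\mathfrak{m}_0)_i=0$ for $i\le 0$. A derivation of a Lie algebra $\mathfrak{g}$ is a linear map $D:\mathfrak{g}\to\mathfrak{g}$ with $D([x,y])=[D(x),y]+[x,D(y)]$ for all $x,y$. A biderivation of $\mathfrak{g}$ is a skew-symmetric ($f(x,y)=-f(y,x)$) bilinear map $f:\mathfrak{g}\times\mathfrak{g}\to\mathfrak{g}$ such that for every $x\in\mathfrak{g}$ both maps $y\mapsto f(x,y)$ and $y\mapsto f(y,x)$ are derivations of $\mathfrak{g}$;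 $\mathrm{BDer}(\mathfrak{g})$ is the space of biderivations. For $\mathfrak{g}=\bigoplus_{i\ge1}\mathfrak{g}_i$ graded, $\mathrm{BDer}_k(\mathfrak{g})=\{f\in\mathrm{BDer}(\mathfrak{g})\mid f(\mathfrak{g}_i,\mathfrak{g}_j)\subseteq\mathfrak{g}_{k+i+j}\text{ for all } i,j\in\mathbb{N}\}$. For $i<j$, $e^{i,j}_{k}$ denotes the skew-symmetric bilinear map sending $(e_i,e_j)$ to $e_k$ (hence $(e_j,e_i)$ to $-e_k$) and every other pair of basis vectors to $0$; infinite sums of such maps are understood by evaluation on pairs of basis vectors. *)

(* Defs.v *)
From HB Require Import structures.
From mathcomp Require Import all_boot all_order all_algebra.
From mathcomp Require Import ring.
From mathcomp Require Import boolp classical_sets functions cardinality fsbigop.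

Set Implicit Arguments.
Unset Strict Implicit.
Unset Printing Implicit Defensive.

Import Order.TTheory GRing.Theory Num.Theory.
Local Open Scope classical_set_scope.
Local Open Scope ring_scope.

HB.mixin Record Lmodule_isLieAlgebra (F : fieldType) L of GRing.Lmodule F L := {
  lie : L -> L -> L;
  lie_linearl : forall y, linear (lie^~ y);
  lie_linearr : forall x, linear (lie x);
  liexx : forall x, lie x x = 0;
  lie_jacobi : forall x y z,
    lie x (lie y z) + lie y (lie z x) + lie z (lie x y) = 0
}.

#[short(type="lieAlgType")]
HB.structure Definition LieAlgebra (F : fieldType) :=
  { L of GRing.Lmodule F L & Lmodule_isLieAlgebra F L }.

Section Span.
Variables (F : fieldType) (V : lmodType F).

Definition span_of n (b : 'I_n -> V) : set V :=
  [set v | exists a : 'I_n -> F, v = \sum_(i < n) a i *: b i].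

Definition lin_indep n (b : 'I_n -> V) : Prop :=
  forall a : 'I_n -> F, \sum_(i < n) a i *: b i = 0 -> forall i, a i = 0.

Definition has_dim (W : set V) (n : nat) : Prop :=
  exists b : 'I_n -> V, lin_indep b /\ W = span_of b.

End Span.

Section Biderivations.
Variables (F : fieldType) (L : lieAlgType F).

Definition is_derivation (D : L -> L) : Prop :=
  linear D /\ forall x y, D (lie x y) = lie (D x) y + lie x (D y).

Definition bilinear_map (f : L -> L -> L) : Prop :=
  (forall y, linear (f^~ y)) /\ (forall x, linear (f x)).

Definition skew_map (f : L -> L -> L) : Prop := forall x y, f x y = - f y x.

Definition BDer : set (L -> L -> L) :=
  [set f | [/\ bilinear_map f, skew_map f &
     forall x, is_derivation (f x) /\ is_derivation (f^~ x)]].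

(* [g d] is the component of degree [d]; the degree ranges over all of [int]
   because [k + i + j] may be negative, but [i] and [j] are positive. *)
Definition BDer_deg (g : int -> set L) (k : int) : set (L -> L -> L) :=
  [set f | BDer f /\
     forall i j : nat, (0 < i)%N -> (0 < j)%N ->
     forall x y, g i%:Z x -> g j%:Z y -> g (k + i%:Z + j%:Z) (f x y)].

End Biderivations.

(* The space of finite linear combinations of e_1, e_2, ... is modelled by
   polynomials, e_i being 'X^(i - 1); only the linear structure is kept. *)
Definition m0 (F : fieldType) : Type := {poly F}.
HB.instance Definition _ (F : fieldType) := GRing.Lmodule.copy (m0 F) {poly F}.

Section M0.
Variable F : fieldType.

(* With e_i = 0 for i <= 0, the degree i component is F e_i for every i. *)
Definition m0_e (i : int) : m0 F := if i is Posz n.+1 then 'X^n else 0.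

Definition m0_coord (i : nat) (x : m0 F) : F := (x : {poly F})`_i.-1.

Definition m0_comp (i : int) : set (m0 F) :=
  [set x | exists a : F, x = a *: m0_e i].

Lemma m0_coord_e (i j : nat) : (0 < i)%N -> (0 < j)%N ->
  m0_coord i (m0_e j%:Z) = (i == j)%:R.
Proof. by case: i j => [|i] [|j] // _ _; rewrite /m0_coord /m0_e /= coefXn eqSS. Qed.

Lemma m0_coord_sum (x : m0 F) :
  x = \sum_(1 <= i < (size (x : {poly F})).+1) m0_coord i x *: m0_e i%:Z.
Proof.
rewrite big_add1 /= big_mkord.
by rewrite -[LHS](@coefK F) poly_def.
Qed.

(* Closed form of the bracket: multiplication by 'X is the shift
   e_i |-> e_(i+1), and the e_1-terms of x_1 y - y_1 x cancel out.  Its values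
   on basis vectors, which determine it, are given by [lie_e1] and [lie_ee]. *)
Definition m0_lie (x y : m0 F) : m0 F :=
  ('X : {poly F}) * (m0_coord 1 x *: (y : {poly F}) - m0_coord 1 y *: (x : {poly F})).

Fact m0_lie_linearr (x : {poly F}) : linear (m0_lie x : {poly F} -> {poly F}).
Proof.
move=> a u v; rewrite /m0_lie /m0_coord coefD coefZ -!mul_polyC polyCD polyCM.
ring.
Qed.

Fact m0_lieC (x y : {poly F}) : m0_lie x y = - (m0_lie y x : {poly F}).
Proof. by rewrite /m0_lie -mulrN opprB. Qed.

Fact m0_lie_linearl (y : {poly F}) :
  linear ((fun x => m0_lie x y) : {poly F} -> {poly F}).
Proof.
move=> a u v; rewrite m0_lieC m0_lie_linearr [in LHS]m0_lieC.
by rewrite [m0_lie y v]m0_lieC scalerN opprD !opprK.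
Qed.

Fact m0_liexx (x : {poly F}) : m0_lie x x = 0 :> {poly F}.
Proof. by rewrite /m0_lie subrr mulr0. Qed.

Fact m0_lie_jacobi (x y z : {poly F}) :
  (m0_lie x (m0_lie y z) : {poly F}) + (m0_lie y (m0_lie z x) : {poly F})
  + (m0_lie z (m0_lie x y) : {poly F}) = 0.
Proof.
rewrite /m0_lie /m0_coord !coefXM /= !scale0r !subr0 -!mul_polyC.
ring.
Qed.

HB.instance Definition _ := Lmodule_isLieAlgebra.Build F (m0 F)
  m0_lie_linearl m0_lie_linearr m0_liexx m0_lie_jacobi.

Lemma lie_e1 (i : nat) : (2 <= i)%N -> lie (m0_e 1) (m0_e i%:Z) = m0_e (i%:Z + 1).
Proof.
move=> i2; rewrite -[LHS]/(m0_lie (m0_e 1%:Z) _) /m0_lie.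
rewrite !m0_coord_e ?(ltnW i2) //= ltn_eqF //= scale1r scale0r subr0.
rewrite addn1.
by case: i i2 => // i _; rewrite /m0_e /= exprS.
Qed.

Lemma lie_ee (i j : nat) : (2 <= i)%N -> (2 <= j)%N ->
  lie (m0_e i%:Z) (m0_e j%:Z) = 0.
Proof.
move=> i2 j2; rewrite -[LHS]/(m0_lie _ _) /m0_lie.
by rewrite !m0_coord_e ?(ltnW i2, ltnW j2) // !ltn_eqF //= !scale0r subr0 mulr0.
Qed.

(* The bilinear map taking the value c i j on (e_i, e_j), for i, j >= 1. *)
Definition bilin_ext (c : nat -> nat -> m0 F) (x y : m0 F) : m0 F :=
  \sum_(1 <= i < (size (x : {poly F})).+1)
    \sum_(1 <= j < (size (y : {poly F})).+1) (m0_coord i x * m0_coord j y) *: c i j.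

Lemma bilin_ext_e c (i j : nat) : (0 < i)%N -> (0 < j)%N ->
  bilin_ext c (m0_e i%:Z) (m0_e j%:Z) = c i j.
Proof.
case: i j => [|i] [|j] // _ _; rewrite /bilin_ext.
rewrite -[m0_e i.+1%:Z]/('X^i) -[m0_e j.+1%:Z]/('X^j) !size_polyXn.
rewrite big_nat_recr //= big_nat big1 ?add0r => [|a /andP[a0 ai]]; last first.
  rewrite big1 // => b _; rewrite (@m0_coord_e a i.+1) //.
  by rewrite ltn_eqF // mul0r scale0r.
rewrite big_nat_recr //= big_nat big1 ?add0r => [|b /andP[b0 bj]]; last first.
  by rewrite (@m0_coord_e b j.+1) // ltn_eqF // mulr0 scale0r.
by rewrite (@m0_coord_e i.+1 i.+1) // (@m0_coord_e j.+1 j.+1) // !eqxx mulr1 scale1r.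
Qed.

Lemma bilin_ext_bilinear c : bilinear_map (bilin_ext c).
Proof.
pose B n (x y : {poly F}) : m0 F := \sum_(1 <= i < n.+1) \sum_(1 <= j < n.+1)
  (m0_coord i x * m0_coord j y) *: c i j.
have coord_big (z : {poly F}) i : (size z < i)%N -> m0_coord i z = 0.
  by case: i => // i /= zi; rewrite /m0_coord nth_default.
have extE n x y : (size (x : {poly F}) <= n)%N ->
    (size (y : {poly F}) <= n)%N -> bilin_ext c x y = B n x y.
  move=> xn yn; rewrite /bilin_ext /B.
  rewrite [RHS](big_cat_nat _ (n := (size (x : {poly F})).+1)) //=.
  rewrite [X in _ + X]big_nat [X in _ + X]big1 ?addr0 => [|i /andP[ix _]];
    last by rewrite big1 // => j _; rewrite coord_big // mul0r scale0r.
  apply: eq_bigr => i _.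
  rewrite [RHS](big_cat_nat _ (n := (size (y : {poly F})).+1)) //=.
  rewrite [X in _ + X]big_nat [X in _ + X]big1 ?addr0 // => j /andP[jy _].
  by rewrite [m0_coord j y]coord_big // mulr0 scale0r.
have coordP i : scalar (m0_coord i : {poly F} -> F).
  by move=> a u v; rewrite /m0_coord coefD coefZ.
have le3 (p q r : nat) : [/\ p <= maxn p (maxn q r), q <= maxn p (maxn q r)
    & r <= maxn p (maxn q r)]%N.
  by rewrite !leq_max !leqnn !orbT.
split=> z a u v.
  have [up vp zp] := le3 (size (u : {poly F})) (size (v : {poly F}))
    (size (z : {poly F})).
  have wp := leq_trans (size_polyD (a *: (u : {poly F})) v) _.
  rewrite !(@extE (maxn (size (u : {poly F})) (maxn (size (v : {poly F}))
    (size (z : {poly F}))))) //; last first.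
    by apply: wp; rewrite geq_max vp (leq_trans (size_scale_leq _ _)).
  rewrite /B scaler_sumr -big_split /=; apply: eq_bigr => i _.
  rewrite scaler_sumr -big_split /=; apply: eq_bigr => j _.
  by rewrite (coordP i) scalerA -scalerDl mulrDl mulrA.
have [up vp zp] := le3 (size (u : {poly F})) (size (v : {poly F}))
  (size (z : {poly F})).
have wp := leq_trans (size_polyD (a *: (u : {poly F})) v) _.
rewrite !(@extE (maxn (size (u : {poly F})) (maxn (size (v : {poly F}))
  (size (z : {poly F}))))) //; last first.
  by apply: wp; rewrite geq_max vp (leq_trans (size_scale_leq _ _)).
rewrite /B scaler_sumr -big_split /=; apply: eq_bigr => i _.
rewrite scaler_sumr -big_split /=; apply: eq_bigr => j _.
by rewrite (coordP j) scalerA -scalerDl mulrDr mulrCA.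
Qed.

(* The map e^{i,j}_k, for 1 <= i < j. *)
Definition elem_map (i j : nat) (k : int) : m0 F -> m0 F -> m0 F :=
  bilin_ext (fun a b =>
    if (a == i) && (b == j) then m0_e k
    else if (a == j) && (b == i) then - m0_e k else 0).

(* The infinite sum over i in A of the bilinear maps u i, by evaluation on
   pairs of basis vectors.  [\sum_(i \in A)] is a sum with finite support, and
   is 0 when the support is infinite. *)
Definition bilin_sum (A : set nat) (u : nat -> m0 F -> m0 F -> m0 F) :
    m0 F -> m0 F -> m0 F :=
  bilin_ext (fun a b => \sum_(i \in A) u i (m0_e a%:Z) (m0_e b%:Z)).

Definition bder_gen (k : int) : m0 F -> m0 F -> m0 F :=
  bilin_sum [set i | (2 <= i)%N] (fun i => elem_map 1 i (1 + i%:Z + k)).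

End M0.

Arguments m0_e F i : clear implicits.
Arguments bder_gen F k : clear implicits.
Arguments m0_comp F i : clear implicits.

(* Main.v *)
(* Writing e_i as 'X^(i-1) and x_0 for the constant coefficient of x, the bracket
   is X (x_0 y - y_0 x), and a biderivation is always h (x_0 y - y_0 x) for a
   polynomial h, without any grading assumption.  Let g = f(e_1, e_2).  As
   f(e_1, e_1) = 0, the derivation f(e_1, -) gives f(e_1, e_3) = [e_1, g], and
   applying it to [e_2, e_3] = 0 gives g_0 = 0.  Hence g = X h and
   f(e_1, e_j) = X^(j-1) h for all j >= 2.  Now f(e_i, e_1) has no constant
   coefficient, so f(e_i, e_(j+1)) = [e_1, f(e_i, e_j)] for i, j >= 2; from
   f(e_2, e_2) = 0 this gives f(e_2, -) = 0, then f(e_i, e_2) = 0 and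
   f(e_i, e_j) = 0.  In degree k, X h is a multiple of e_(k+3), that is, h is a
   multiple of X^(k+1), and h = 0 when k <= -2. *)
From HB Require Import structures.
Require Import Defs.
From mathcomp Require Import all_boot all_order all_algebra.
From mathcomp Require Import boolp classical_sets functions cardinality fsbigop.
From mathcomp Require Import ring zify.

Local Open Scope classical_set_scope.
Local Open Scope ring_scope.

Import Order.TTheory GRing.Theory Num.Theory.

Lemma linear_poly_ext (F : fieldType) (D E : {poly F} -> {poly F}) :
  linear D -> linear E -> (forall n, D 'X^n = E 'X^n) -> D =1 E.
Proof.
move=> lD lE DE p.
pose D' : {linear {poly F} -> {poly F}} := HB.pack D (GRing.isLinear.Build _ _ _ _ D lD).
pose E' : {linear {poly F} -> {poly F}} := HB.pack E (GRing.isLinear.Build _ _ _ _ E lE).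
rewrite -[p]coefK poly_def -[D]/(D' : _ -> _) -[E]/(E' : _ -> _) !linear_sum.
by apply: eq_bigr => i _; rewrite !linearZ /= DE.
Qed.

Lemma bilinear_m0_ext (F : fieldType) (f g : m0 F -> m0 F -> m0 F) :
  bilinear_map f -> bilinear_map g ->
  (forall m n, f ('X^m : {poly F}) ('X^n : {poly F}) =
               g ('X^m : {poly F}) ('X^n : {poly F})) ->
  f = g.
Proof.
move=> [fl fr] [gl gr] fg; apply/funext => x; apply/funext => y.
apply: (linear_poly_ext _ _ _ (fr x) (gr x)) => n.
by apply: (linear_poly_ext _ _ _ (fl _) (gl _)) => m; apply: fg.
Qed.

(** This is the candidate family for all biderivations: the bracket itself with the shift ['X]
    replaced by multiplication by any [h]. *)
Definition poly_bider (F : fieldType) (h : {poly F}) (x y : m0 F) : m0 F :=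
  h * ((x : {poly F})`_0 *: (y : {poly F}) - (y : {poly F})`_0 *: (x : {poly F})).

Lemma lie_m0E (F : fieldType) (x y : m0 F) : lie x y = poly_bider F 'X x y.
Proof. by []. Qed.

Lemma poly_biderC (F : fieldType) (h : {poly F}) : skew_map (poly_bider F h).
Proof. by move=> x y; rewrite /poly_bider -[RHS]mulrN opprB. Qed.

Lemma poly_bider_linearr (F : fieldType) (h : {poly F}) (x : m0 F) :
  linear (poly_bider F h x).
Proof.
move=> a u v; rewrite /poly_bider.
rewrite -[a *: u]/(a *: (u : {poly F})) -[_ + v]/(_ + (v : {poly F})).
rewrite coefD coefZ -!mul_polyC polyCD polyCM; ring.
Qed.

Lemma poly_bider_bilinear (F : fieldType) (h : {poly F}) :
  bilinear_map (poly_bider F h).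
Proof.
split=> [y a u v|]; last exact: poly_bider_linearr.
rewrite poly_biderC poly_bider_linearr [in RHS]poly_biderC.
by rewrite [in RHS](poly_biderC _ _ v) scalerN opprD.
Qed.

(** Values of [lie] and of [poly_bider F h] have constant coefficient 0, the latter because x_0 y_0
    - y_0 x_0 = 0. What remains of the derivation rule is an identity in the commutative ring
    [{poly F}]. *)
Lemma poly_bider_BDer (F : fieldType) (h : {poly F}) : BDer (poly_bider F h).
Proof.
have [fl fr] := poly_bider_bilinear F h.
split=> // [|x]; first exact: poly_biderC.
by split; split=> // u v; rewrite !lie_m0E /poly_bider;
  rewrite -[X in _ = X]/((_ : {poly F}) + (_ : {poly F}));
  rewrite !coef0M !coefB !coefZ coefX /= -!mul_polyC
    !(polyCD, polyCM, polyCN, polyC0); ring.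
Qed.

Lemma coef0_eq0_mulX (F : fieldType) (p : {poly F}) : p`_0 = 0 ->
  exists q, p = 'X * q.
Proof.
move=> p0; have /dvdpP[q ->] : 'X %| p.
  by rewrite -['X]subr0 -polyC0 dvdp_XsubCl /root horner_coef0 p0.
by exists q; rewrite mulrC.
Qed.

Lemma lie1 (F : fieldType) (p : m0 F) : (p : {poly F})`_0 = 0 ->
  lie ((1 : {poly F}) : m0 F) p = 'X * (p : {poly F}).
Proof. by move=> p0; rewrite lie_m0E /poly_bider coef1 p0 scale1r scale0r subr0. Qed.

Lemma lie_no_e1 (F : fieldType) (p q : m0 F) :
  (p : {poly F})`_0 = 0 -> (q : {poly F})`_0 = 0 -> lie p q = 0.
Proof. by move=> p0 q0; rewrite lie_m0E /poly_bider p0 q0 !scale0r subrr mulr0. Qed.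

Lemma BDer_poly_bider (F : fieldType) (f : m0 F -> m0 F -> m0 F) :
  2 != 0 :> F -> BDer f -> exists h, f = poly_bider F h.
Proof.
move=> F2 [fbil fC fder].
(* Index shift: [e n] is e_(n+1), so [e 0] is e_1 and [e 1] is e_2. *)
pose e n : m0 F := ('X^n : {poly F}).
have fxx x : f x x = 0.
  apply/eqP; have /eqP := fC x x.
  rewrite -subr_eq0 opprK -mulr2n -scaler_nat scaler_eq0.
  by rewrite (negbTE F2).
have derR x u v : f x (lie u v) = lie (f x u) v + lie u (f x v).
  by have [[_ ->]] := fder x.
have e0 n : (e n.+1 : {poly F})`_0 = 0 by rewrite coefXn.
have eS n : e n.+2 = lie (e 0) (e n.+1) by rewrite lie1 // -exprS.
have f0x x : f x 0 = 0.
  (* Linearity with scalar -1 at two zero vectors reads f(x, 0) = - f(x, 0) + f(x, 0). *)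
  by have [[lD _] _] := fder x; have := lD (-1) 0 0; rewrite scaler0 addr0 scaleN1r addNr.
have lie0x x : lie (0 : m0 F) x = 0.
  by rewrite lie_m0E poly_biderC /poly_bider coef0 scale0r scaler0 subr0 mulr0 oppr0.
have liex0 x : lie x (0 : m0 F) = 0.
  by rewrite lie_m0E /poly_bider coef0 scale0r scaler0 subr0 mulr0.
have stepE0 n : f (e 0) (e n.+2) = lie (e 0) (f (e 0) (e n.+1)).
  by rewrite eS derR fxx lie0x add0r.
have lie_coef0 (x y : m0 F) : (lie x y : {poly F})`_0 = 0.
  by rewrite lie_m0E /poly_bider coefXM.
(* From [e_2, e_3] = 0 comes 0 = [g, e_3] + [e_2, f(e_1, e_3)] with g = f(e_1, e_2). The last term
   drops because f(e_1, e_3) is a bracket, hence free of e_1, and [g, e_3] = g_0 e_4. *)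
have g0 : (f (e 0) (e 1) : {poly F})`_0 = 0.
  have := derR (e 0) (e 1) (e 2).
  rewrite (lie_no_e1 _ _ _ (e0 0%N) (e0 1%N)) f0x stepE0.
  rewrite (lie_no_e1 _ _ _ (e0 0%N) (lie_coef0 _ _)) addr0.
  rewrite lie_m0E /poly_bider coefXn scale0r subr0 => /esym/eqP.
  rewrite -[_ == 0]/((_ : {poly F}) == 0) mulf_eq0 polyX_eq0 /= scaler_eq0.
  by rewrite -size_poly_eq0 size_polyXn orbF => /eqP.
have [h gh] := coef0_eq0_mulX _ _ g0.
have f1 n : f (e 0) (e n.+1) = 'X^(n.+1) * h.
  elim: n => [|n IH]; first by rewrite gh.
  have c0 : ('X^(n.+1) * h)`_0 = 0 by rewrite exprS -mulrA coefXM.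
  by rewrite stepE0 IH (lie1 _ _ c0) mulrA -exprS.
have f1' n : f (e n.+1) (e 0) = - ('X^(n.+1) * h) by rewrite fC f1.
have f1'0 n : (f (e n.+1) (e 0) : {poly F})`_0 = 0.
  by rewrite f1' exprS -mulrA coefN coefXM oppr0.
have stepS m n : f (e m.+1) (e n.+2) = lie (e 0) (f (e m.+1) (e n.+1)).
  by rewrite eS derR lie_no_e1 // add0r.
have f2 n : f (e 1) (e n.+1) = 0.
  by elim: n => [|n IH]; [apply: fxx | rewrite stepS IH liex0].
have fSS m n : f (e m.+1) (e n.+1) = 0.
  elim: n => [|n IH]; last by rewrite stepS IH liex0.
  by rewrite fC f2 oppr0.
exists h; apply: bilinear_m0_ext => //; first exact: poly_bider_bilinear.
case=> [|m] [|n]; rewrite -/(e _) -?/(e _).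
- by rewrite fxx /poly_bider subrr mulr0.
- by rewrite f1 /poly_bider !coefXn /= scale1r scale0r subr0 mulrC.
- by rewrite f1' /poly_bider !coefXn /= scale1r scale0r sub0r mulrN mulrC.
- by rewrite fSS /poly_bider !coefXn /= !scale0r subrr mulr0.
Qed.

(** Multiplication by ['X^n] sends e_i to e_(n+i), which is e_(1+i+k) for k = n - 1. *)
Lemma bder_genE (F : fieldType) (n : nat) :
  bder_gen F (n%:Z - 1) = poly_bider F 'X^n.
Proof.
apply: bilinear_m0_ext => [||i j]; first exact: bilin_ext_bilinear.
  exact: poly_bider_bilinear.
rewrite -[X in bder_gen _ _ X]/(m0_e F i.+1%:Z) -[X in bder_gen _ _ _ X]/(m0_e F j.+1%:Z).
rewrite /bder_gen /bilin_sum bilin_ext_e //.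
under eq_fsbigr => a _ do rewrite /elem_map bilin_ext_e //.
have eX (m : nat) : m0_e F (1 + m.+2%:Z + (n%:Z - 1)) = 'X^(n + m.+1).
  by have -> : 1 + m.+2%:Z + (n%:Z - 1) = (n + m.+1).+1%:Z by lia.
rewrite /poly_bider !coefXn.
(* On each pair of basis vectors at most one index r >= 2 contributes, so the sum has finite support
   and its default value 0 never intervenes. *)
have single m (c : nat -> m0 F) : \sum_(r \in [set r | (2 <= r)%N])
    (if m.+2 == r then c r else 0) = c m.+2.
  rewrite -(fsbig_widen [set m.+2]) ?fsbig_set1 ?eqxx // => [r ->//|r [_ /= /eqP]].
  by rewrite eq_sym => /negbTE ->.
case: i j => [|i] [|j] /=.
(* Only r = 1 could match the pair (e_1, e_1), and the range excludes it. *)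
- rewrite !scale1r subrr mulr0 fsbig1 // => r; rewrite /= => r2.
  by case: r r2 => [|[|r]].
- under eq_fsbigr => r _ do rewrite !eqSS andbF.
  rewrite single eX.
  by rewrite scale1r scale0r subr0 exprD.
- under eq_fsbigr => r _ do rewrite andbT.
  by rewrite single eX scale1r scale0r sub0r mulrN exprD.
- rewrite !scale0r subrr mulr0 fsbig1 // => r _.
  by rewrite andbF.
Qed.

(** The degree condition is tested on the single value f(e_1, e_2) = X h, of degree k + 1 + 2. *)
Lemma BDer_deg_poly_bider (F : fieldType) (k : int) (f : m0 F -> m0 F -> m0 F) :
  2 != 0 :> F -> BDer_deg (m0_comp F) k f ->
  exists h : {poly F}, f = poly_bider F h /\ m0_comp F (k + 3) ('X * h).
Proof.
move=> F2 [/(BDer_poly_bider _ _ F2)[h ->] fdeg]; exists h; split=> //.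
have := fdeg 1%N 2%N isT isT (m0_e F 1) (m0_e F 2).
rewrite -addrA /poly_bider !coefXn /= scale1r scale0r subr0 mulrC.
by apply; exists 1; rewrite scale1r.
Qed.

Lemma poly_bider0 (F : fieldType) : poly_bider F 0 = 0.
Proof. by apply/funext => x; apply/funext => y; exact: mul0r. Qed.

Lemma poly_biderZ (F : fieldType) (a : F) (h : {poly F}) :
  poly_bider F (a *: h) = a *: (poly_bider F h : m0 F -> m0 F -> m0 F).
Proof.
apply/funext => x; apply/funext => y.
by rewrite -[RHS]/(a *: (poly_bider F h x y : {poly F})) /poly_bider scalerAl.
Qed.

(** As k + 3 <= 1, the component containing ['X * h] is F e_1 or 0, so ['X * h] is a constant
    polynomial; being divisible by ['X], it is 0. *)
Lemma BDer_deg_lt (F : fieldType) (k : int) : 2 != 0 :> F -> k <= -2 ->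
  BDer_deg (m0_comp F) k = [set 0].
Proof.
move=> F2 k2; apply/seteqP; split=> f /=.
  move=> /(BDer_deg_poly_bider _ _ _ F2)[h [-> [a ah]]].
  suff -> : h = 0 by exact: poly_bider0.
  apply/polyP => i; have -> : h`_i = ('X * h)`_i.+1 by rewrite coefXM.
  rewrite ah; have : k + 3 <= 1 by lia.
  by case: (k + 3) => [[|[|m]]|m] // _; rewrite coefZ ?coef0 ?coefXn /= mulr0.
move=> ->; split; first by rewrite -poly_bider0; exact: poly_bider_BDer.
by move=> i j _ _ x y _ _; exists 0; rewrite scale0r.
Qed.

Lemma BDer_deg_ge (F : fieldType) (n : nat) : 2 != 0 :> F ->
  BDer_deg (m0_comp F) (n%:Z - 1) =
  [set f | exists a : F, f = a *: (bder_gen F (n%:Z - 1) : m0 F -> m0 F -> m0 F)].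
Proof.
move=> F2; rewrite bder_genE; apply/seteqP; split=> f /=.
  move=> /(BDer_deg_poly_bider _ _ _ F2)[h [-> [a ah]]].
  exists a; rewrite -poly_biderZ; congr poly_bider.
  apply: (mulfI (negbT (polyX_eq0 F))); rewrite ah.
  have -> : n%:Z - 1 + 3 = n.+2%:Z by lia.
  by rewrite -scalerAr -exprS.
move=> [a ->]; rewrite -poly_biderZ; split; first exact: poly_bider_BDer.
move=> [|i] [|j] // _ _ _ _ [b ->] [c ->].
have -> : n%:Z - 1 + i.+1%:Z + j.+1%:Z = (n + i + j).+1%:Z by lia.
(* The arguments are now b e_(i+1) and c e_(j+1); the indicators are the constant coefficients of
   e_(i+1) and e_(j+1). *)
rewrite /m0_comp /=; exists (a * b * c * ((i == 0%N)%:R - (j == 0%N)%:R)).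
rewrite /poly_bider !coefZ !coefXn.
rewrite -[in RHS]/('X^(n + i + j)) !exprD.
rewrite -!mul_polyC !(polyCD, polyCM, polyCN).
case: i j => [|i] [|j]; rewrite /= ?polyC1 ?polyC0; ring.
Qed.

Theorem theorem2p1 (F : closedFieldType) (charF0 : [pchar F] =i pred0)
    (k : int) :
  (-1 <= k -> has_dim (BDer_deg (m0_comp F) k) 1) /\
  (k <= -2 -> has_dim (BDer_deg (m0_comp F) k) 0) /\
  (-1 <= k ->
     [/\ BDer_deg (m0_comp F) k = span_of (fun _ : 'I_1 => bder_gen F k),
         bilinear_map (bder_gen F k) /\ skew_map (bder_gen F k),
         forall i : nat, (2 <= i)%N ->
           bder_gen F k (m0_e F 1) (m0_e F i%:Z) = m0_e F (1 + i%:Z + k) &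
         forall i j : nat, (2 <= i)%N -> (2 <= j)%N ->
           bder_gen F k (m0_e F i%:Z) (m0_e F j%:Z) = 0]).
Proof.
have F2 : 2 != 0 :> F by rewrite ((pcharf0P F).1 charF0).
have kE : -1 <= k -> exists n : nat, k = n%:Z - 1.
  by move=> k1; exists (absz (k + 1)); lia.
have spanE : -1 <= k ->
    BDer_deg (m0_comp F) k = span_of (fun _ : 'I_1 => bder_gen F k).
  move=> /kE[n ->]; rewrite BDer_deg_ge //; apply/seteqP; split=> f /=.
    by move=> [a ->]; exists (fun=> a); rewrite big_ord1.
  by move=> [a ->]; exists (a ord0); rewrite big_ord1.
have gen1 n i : (2 <= i)%N -> bder_gen F (n%:Z - 1) (m0_e F 1) (m0_e F i%:Z) =
    m0_e F (1 + i%:Z + (n%:Z - 1)).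
  case: i => [|[|i]] // _; rewrite bder_genE /poly_bider !coefXn /=.
  rewrite scale1r scale0r subr0 -exprD.
  by have -> : 1 + i.+2%:Z + (n%:Z - 1) = (n + i.+1).+1%:Z by lia.
split; [move=> k1 | split; [move=> k2 | move=> k1]].
- exists (fun=> bder_gen F k); split; last exact: spanE.
  move=> a; rewrite big_ord1 => a0 i; rewrite ord1.
  have [n kn] := kE k1; move: a0; rewrite kn => a0.
  (* The generator is nonzero: its value at (e_1, e_2) is e_(n+2), which is ['X^(n.+1)]. *)
  have := congr1 (fun f => f (m0_e F 1) (m0_e F 2)) a0.
  rewrite -[LHS]/(a ord0 *: (bder_gen F _ (m0_e F 1) (m0_e F 2%N%:Z))) gen1 //.
  have -> : 1 + 2%N%:Z + (n%:Z - 1) = n.+2%:Z by lia.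
  rewrite -[RHS]/(0 : {poly F}) => /eqP.
  rewrite -[_ == _]/((a ord0 *: 'X^(n.+1) : {poly F}) == 0) scaler_eq0.
  by rewrite -size_poly_eq0 size_polyXn orbF => /eqP.
- exists (fun=> 0); split; first by move=> a _ [].
  rewrite BDer_deg_lt //; apply/seteqP; split=> f /=.
    by move=> ->; exists (fun=> 0); rewrite big_ord0.
  by move=> [a ->]; rewrite big_ord0.
- have [n kn] := kE k1; split; first exact: spanE.
  + rewrite kn bder_genE; split; first exact: poly_bider_bilinear.
    exact: poly_biderC.
  + by rewrite kn; exact: gen1.
  + rewrite kn => -[|[|i]] [|[|j]] // _ _; rewrite bder_genE /poly_bider.
    by rewrite !coefXn /= !scale0r subrr mulr0.
Qed.
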